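(* For every $n\geq 3$ there exist an $n$-dimensional degenerate linear subspace $\mathbb{W}^n$ of $\mathbb{L}^{n+1}$ and isometric cohomogeneity one actions (of subgroups $H_1,H_2$ of $I(\mathbb{L}^{n+1})$ leaving $\mathbb{W}^n$ invariant) on $\mathbb{L}^{n+1}$ which are orbit-equivalent on the complement $\mathbb{L}^{n+1}\setminus\mathbb{W}^n$ and not orbit-equivalent on $\mathbb{W}^n$.
   Context: $\mathbb{L}^{n+1}$ is the $(n+1)$-dimensional Minkowski space $\mathbb{R}^{n+1}$ with inner product $\langle u,v\rangle = \sum_{i=1}^n u_iv_i - u_{n+1}v_{n+1}$, and $I(\mathbb{L}^{n+1}) = O_{n,1}\ltimes\mathbb{L}^{n+1}$ is its isometry group, with $(x,u)$ acting by $p\mapsto xp+u$. A linear subspace is degenerate if the restriction of $\langle\cdot,\cdot\rangle$ to it is degenerate. An isometric action on $\mathbb{L}^{n+1}$ is of cohomogeneity one if the minimal codimension of its orbits is one. For a subset $X\subset\mathbb{L}^{n+1}$ invariant under two isometric actions, the actions are orbit-equivalent on $X$ if there is an isometry $f$ of $\mathbb{L}^{n+1}$ with $f(X)=X$ that maps the orbits of the first action contained in $X$ onto the orbits of the second action contained in $X$. *)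

(* Defs.v *)
From HB Require Import structures.
From mathcomp Require Import all_boot all_order all_algebra.
From mathcomp Require Import all_classical all_reals all_analysis.

Set Implicit Arguments.
Unset Strict Implicit.
Unset Printing Implicit Defensive.

Import Order.TTheory GRing.Theory Num.Theory.
Import numFieldNormedType.Exports.

Local Open Scope classical_set_scope.
Local Open Scope ring_scope.

(* The last coordinate, of index [ord_max], is the timelike one. *)
Definition mink (R : realType) (n : nat) (u v : 'cV[R]_n.+1) : R :=
  \sum_(i < n) u (widen_ord (leqnSn n) i) 0 * v (widen_ord (leqnSn n) i) 0
  - u ord_max 0 * v ord_max 0.

Definition degenerate (R : realType) (n : nat) (W : {vspace 'cV[R]_n.+1}) : Prop :=
  exists w, [/\ w \in W, w != 0 & forall v, v \in W -> mink w v = 0].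

Definition lorentz (R : realType) (n : nat) : set 'M[R]_n.+1 :=
  [set x | forall u v : 'cV[R]_n.+1, mink (x *m u) (x *m v) = mink u v].

(* The pair (x, u) stands for the affine map p |-> x p + u; it is an isometry
   exactly when x is in O_{n,1}. *)
Definition affine (R : realType) (n : nat) : Type := ('M[R]_n.+1 * 'cV[R]_n.+1)%type.

Definition act (R : realType) (n : nat) (g : affine R n) (p : 'cV[R]_n.+1) :
  'cV[R]_n.+1 := g.1 *m p + g.2.

Definition affine_one (R : realType) (n : nat) : affine R n := (1%:M, 0).

Definition affine_mul (R : realType) (n : nat) (g h : affine R n) : affine R n :=
  (g.1 *m h.1, g.1 *m h.2 + g.2).

Definition affine_inv (R : realType) (n : nat) (g : affine R n) : affine R n :=
  (invmx g.1, - (invmx g.1 *m g.2)).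

Definition isometries (R : realType) (n : nat) : set (affine R n) :=
  [set g | @lorentz R n g.1].

Definition isometry_subgroup (R : realType) (n : nat) (H : set (affine R n)) : Prop :=
  [/\ H `<=` @isometries R n,
      H (affine_one R n),
      forall g h, H g -> H h -> H (affine_mul g h)
    & forall g, H g -> H (affine_inv g)].

Definition orbit_of (R : realType) (n : nat) (H : set (affine R n))
    (p : 'cV[R]_n.+1) : set 'cV[R]_n.+1 :=
  [set act g p | g in H].

Definition invariant_set (R : realType) (n : nat) (H : set (affine R n))
    (X : set 'cV[R]_n.+1) : Prop :=
  forall g, H g -> act g @` X = X.

Definition C1_curve (R : realType) (n : nat) (c : R -> 'cV[R]_n.+1) : Prop :=
  (forall t, derivable c t 1) /\ continuous (derive1 c).

Definition velocities (R : realType) (n : nat) (X : set 'cV[R]_n.+1)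
    (p : 'cV[R]_n.+1) : set 'cV[R]_n.+1 :=
  [set v | exists c : R -> 'cV[R]_n.+1,
     [/\ C1_curve c, c 0 = p, forall t, X (c t) & derive1 c 0 = v]].

(* [T] is the tangent space of [X] at [p], as the linear span of the velocities.
   When [X] is an immersed submanifold, such as an orbit of a Lie subgroup, the
   velocities already form a linear subspace; the span makes the notion
   meaningful for the orbits of an arbitrary subgroup. *)
Definition tangent_space (R : realType) (n : nat) (X : set 'cV[R]_n.+1)
    (p : 'cV[R]_n.+1) (T : {vspace 'cV[R]_n.+1}) : Prop :=
  velocities X p `<=` [set v | v \in T] /\
  forall U : {vspace 'cV[R]_n.+1},
    velocities X p `<=` [set v | v \in U] -> (T <= U)%VS.

Definition orbit_codim (R : realType) (n : nat) (H : set (affine R n))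
    (p : 'cV[R]_n.+1) (k : nat) : Prop :=
  exists2 T : {vspace 'cV[R]_n.+1},
    tangent_space (orbit_of H p) p T & k = (n.+1 - \dim T)%N.

Definition cohomogeneity_one (R : realType) (n : nat) (H : set (affine R n)) : Prop :=
  (exists p, orbit_codim H p 1) /\
  (forall p k, orbit_codim H p k -> (1 <= k)%N).

Definition orbits_in (R : realType) (n : nat) (H : set (affine R n))
    (X : set 'cV[R]_n.+1) : set (set 'cV[R]_n.+1) :=
  [set O | (exists p, O = orbit_of H p) /\ O `<=` X].

Definition orbit_equivalent_on (R : realType) (n : nat) (X : set 'cV[R]_n.+1)
    (H1 H2 : set (affine R n)) : Prop :=
  exists f : affine R n,
    [/\ @isometries R n f, act f @` X = X
      & [set act f @` O | O in orbits_in H1 X] = orbits_in H2 X].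

(* Main.v *)
Require Import Defs.
From HB Require Import structures.
From mathcomp Require Import all_boot all_order all_algebra.
From mathcomp Require Import all_classical all_reals all_analysis.
From mathcomp Require Import ring.

Set Implicit Arguments.
Unset Strict Implicit.
Unset Printing Implicit Defensive.

Import Order.TTheory GRing.Theory Num.Theory.
Import numFieldNormedType.Exports.

Local Open Scope classical_set_scope.
Local Open Scope ring_scope.

(** Let l be a nonzero null vector and W its orthogonal complement, which is a
degenerate hyperplane since l itself lies in W.  The affine hyperplanes parallel
to W are the level sets of the linear form p |-> <l, p>, and W is the level 0.

Two groups of isometries preserving this form are compared: [level_group l], the
group of all of them, and [ruled_group l], the subgroup of those that move each
point of W only in the direction of l.  The first contains the translations by
vectors of W, so its orbits are exactly the levels ([level_orbit]).  The second
contains the null rotations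

  v |-> v + <l, v> w - <w, v> l - (<w, w> / 2) <l, v> l,    w in W,

and the translations along l.  Such a rotation displaces a point of level c by
c w modulo l; hence if c <> 0 the choice of w gives every displacement in W
modulo l, and a translation along l corrects the rest, so that the ruled group
is transitive on each nonzero level ([ruled_orbit]).  On W, where c = 0, its
orbits stay inside lines parallel to l.

Therefore both groups have the same orbits off W, namely hyperplanes, so that the
identity is an orbit equivalence there and both actions have cohomogeneity one.
On W the level group has W itself as an orbit, whereas every orbit of the ruled
group in W lies in a line; since dim W = n > 1, no isometry maps the orbits of
one group to those of the other ([ruled_not_equivalent]). *)

(** * The Minkowski form *)

(** The covector <u, .>, written as a row so that null rotations become matrix
expressions. *)
Definition lower (R : realType) (n : nat) (u : 'cV[R]_n.+1) : 'rV[R]_n.+1 :=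
  \row_i (if i == ord_max then - u i 0 else u i 0).

Lemma mink_lower (R : realType) (n : nat) (u v : 'cV[R]_n.+1) :
  lower u *m v = (mink u v)%:M.
Proof.
apply/matrixP => i j; rewrite !ord1 !mxE eqxx mulr1n big_ord_recr /=.
rewrite !mxE eqxx mulNr /mink; congr (_ - _); apply: eq_bigr => k _.
by rewrite mxE -val_eqE /= ltn_eqF.
Qed.

Lemma minkE (R : realType) (n : nat) (u v : 'cV[R]_n.+1) :
  mink u v = (lower u *m v) 0 0.
Proof. by rewrite mink_lower mxE eqxx mulr1n. Qed.

Lemma minkC (R : realType) (n : nat) (u v : 'cV[R]_n.+1) : mink u v = mink v u.
Proof.
by rewrite /mink mulrC; congr (_ - _); apply: eq_bigr => i _; rewrite mulrC.
Qed.

Lemma minkDr (R : realType) (n : nat) (u v w : 'cV[R]_n.+1) :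
  mink u (v + w) = mink u v + mink u w.
Proof. by rewrite !minkE mulmxDr mxE. Qed.

Lemma minkZr (R : realType) (n : nat) (a : R) (u v : 'cV[R]_n.+1) :
  mink u (a *: v) = a * mink u v.
Proof. by rewrite !minkE -scalemxAr mxE. Qed.

Lemma mink0r (R : realType) (n : nat) (u : 'cV[R]_n.+1) : mink u 0 = 0.
Proof. by rewrite minkE mulmx0 mxE. Qed.

Lemma minkNr (R : realType) (n : nat) (u v : 'cV[R]_n.+1) :
  mink u (- v) = - mink u v.
Proof. by rewrite !minkE mulmxN mxE. Qed.

Lemma minkDl (R : realType) (n : nat) (u v w : 'cV[R]_n.+1) :
  mink (u + v) w = mink u w + mink v w.
Proof. by rewrite !(minkC _ w) minkDr. Qed.

Lemma minkZl (R : realType) (n : nat) (a : R) (u v : 'cV[R]_n.+1) :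
  mink (a *: u) v = a * mink u v.
Proof. by rewrite !(minkC _ v) minkZr. Qed.

Lemma minkNl (R : realType) (n : nat) (u v : 'cV[R]_n.+1) :
  mink (- u) v = - mink u v.
Proof. by rewrite !(minkC _ v) minkNr. Qed.

Definition mink_linE := (minkDr, minkDl, minkNr, minkNl, minkZr, minkZl).

Lemma mink_delta (R : realType) (n : nat) (u : 'cV[R]_n.+1) (i : 'I_n.+1) :
  mink u (delta_mx i 0) = if i == ord_max then - u i 0 else u i 0.
Proof. by rewrite minkE -colE !mxE. Qed.

Lemma mink_nondegenerate (R : realType) (n : nat) (u : 'cV[R]_n.+1) :
  (forall v, mink u v = 0) -> u = 0.
Proof.
move=> u0; apply/matrixP => i j; rewrite ord1 mxE.
have := u0 (delta_mx i 0); rewrite mink_delta; case: ifP => // _ /eqP.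
by rewrite oppr_eq0 => /eqP.
Qed.

Lemma mink_continuous (R : realType) (n : nat) (u : 'cV[R]_n.+1) :
  continuous (mink u).
Proof.
rewrite (_ : mink u = fun v => \sum_i lower u 0 i * v i 0); last first.
  by apply/funext => v; rewrite minkE mxE.
apply: continuous_big => [|i _ v]; first exact: add_continuous.
apply: (@continuousM R 'cV[R]_n.+1 (cst _) (fun w => w i 0)).
  exact: cst_continuous.
exact: coord_continuous.
Qed.

(** If v^T is in the kernel of x, then <v^T, w> = <x v^T, x w> = 0 for all w, and
the form is nondegenerate.  This is what makes [invmx], hence [affine_inv], a
genuine inverse on isometries. *)
Lemma lorentz_unit (R : realType) (n : nat) (x : 'M[R]_n.+1) :
  @lorentz R n x -> x \in unitmx.
Proof.
move=> xL; rewrite -unitmx_tr -row_free_unit; apply: inj_row_free => v vx0.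
apply: trmx_inj; rewrite trmx0; apply: mink_nondegenerate => w.
rewrite -xL; have -> : x *m v^T = 0 by rewrite -[x]trmxK -trmx_mul vx0 trmx0.
by rewrite minkC mink0r.
Qed.

(** * Affine isometries *)

Lemma act_one (R : realType) (n : nat) (p : 'cV[R]_n.+1) :
  act (affine_one R n) p = p.
Proof. by rewrite /act mul1mx addr0. Qed.

Lemma act_mul (R : realType) (n : nat) (g h : affine R n) (p : 'cV[R]_n.+1) :
  act (affine_mul g h) p = act g (act h p).
Proof. by rewrite /act /= mulmxDr mulmxA addrA. Qed.

Lemma act_invK (R : realType) (n : nat) (g : affine R n) :
  isometries g -> cancel (act (affine_inv g)) (act g).
Proof.
move=> /lorentz_unit gU p.
by rewrite /act /= mulmxDr mulmxN !mulmxA mulmxV // !mul1mx subrK.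
Qed.

Lemma act_inj (R : realType) (n : nat) (g : affine R n) :
  isometries g -> injective (act g).
Proof.
move=> /lorentz_unit gU p q /addIr /(congr1 (mulmx (invmx g.1))).
by rewrite !mulmxA mulVmx // !mul1mx.
Qed.

Lemma isometry_subgroup_isometries (R : realType) (n : nat) :
  isometry_subgroup (@isometries R n).
Proof.
split=> //.
- by move=> u v; rewrite !mul1mx.
- by move=> g h gI hI u v; rewrite -!mulmxA gI hI.
move=> g gI u v; rewrite -gI !mulmxA.
by rewrite mulmxV ?mul1mx //; exact: lorentz_unit.
Qed.

(** * The two groups attached to a vector *)

Definition level_group (R : realType) (n : nat) (l : 'cV[R]_n.+1) :
    set (affine R n) :=
  [set g | isometries g /\ forall p, mink l (act g p) = mink l p].

(** Prescribing the displacement only on the level 0 leaves room for the null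
rotations, which move the other levels in all directions of W. *)
Definition ruled_group (R : realType) (n : nat) (l : 'cV[R]_n.+1) :
    set (affine R n) :=
  [set g | level_group l g /\
           forall p, mink l p = 0 -> act g p - p \in <[l]>%VS].

Lemma level_group_subgroup (R : realType) (n : nat) (l : 'cV[R]_n.+1) :
  isometry_subgroup (level_group l).
Proof.
have [_ I1 IM IV] := isometry_subgroup_isometries R n.
split.
- by move=> g [].
- by split=> // p; rewrite act_one.
- by move=> g h [gI gl] [hI hl]; split=> [|p]; [exact: IM | rewrite act_mul gl].
- move=> g [gI gl]; split=> [|p]; first exact: IV.
  by rewrite -gl act_invK.
Qed.

(** Displacements on W add up along a product, because the level group
preserves W. *)
Lemma ruled_group_subgroup (R : realType) (n : nat) (l : 'cV[R]_n.+1) :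
  isometry_subgroup (ruled_group l).
Proof.
have [LI L1 LM LV] := level_group_subgroup l.
split.
- by move=> g [/LI].
- by split=> // p _; rewrite act_one subrr mem0v.
- move=> g h [gL gr] [hL hr]; split=> [|p p0]; first exact: LM.
  rewrite act_mul -(subrK (act h p) (act g _)) -addrA memvD //; last exact: hr.
  by apply: gr; case: hL => _ ->.
- move=> g [gL gr]; split=> [|p p0]; first exact: LV.
  rewrite -opprB memvN -{1}(act_invK (LI _ gL) p).
  by apply: gr; case: (LV _ gL) => _ ->.
Qed.

(** The unipotent isometry of the stabilizer of l that fixes l and induces on W
the shear v |-> v - <w, v> l; the quadratic term restores the length of the
image of vectors transverse to W. *)
Definition null_rotation (R : realType) (n : nat) (l w : 'cV[R]_n.+1) :
    'M[R]_n.+1 :=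
  1%:M + w *m lower l - l *m lower w - (mink w w / 2) *: (l *m lower l).

Lemma null_rotationE (R : realType) (n : nat) (l w v : 'cV[R]_n.+1) :
  null_rotation l w *m v =
  v + mink l v *: w - mink w v *: l - (mink w w / 2 * mink l v) *: l.
Proof.
rewrite /null_rotation !(mulmxDl, mulNmx) mul1mx -scalemxAl -!mulmxA !mink_lower.
by rewrite !mul_mx_scalar scalerA.
Qed.

Lemma null_rotation_lorentz (R : realType) (n : nat) (l w : 'cV[R]_n.+1) :
  mink l l = 0 -> mink l w = 0 -> @lorentz R n (null_rotation l w).
Proof.
move=> ll lw u v; rewrite !null_rotationE !mink_linE ll (minkC w l) lw.
by rewrite (minkC u w) (minkC u l); field.
Qed.

Lemma ruled_groupW (R : realType) (n : nat) (l w : 'cV[R]_n.+1) (s : R) :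
  mink l l = 0 -> mink l w = 0 -> ruled_group l (null_rotation l w, s *: l).
Proof.
move=> ll lw; split; first split.
- exact: null_rotation_lorentz.
- by move=> p; rewrite /act /= null_rotationE !mink_linE ll lw; ring.
move=> p lp; rewrite /act /= null_rotationE lp scale0r addr0 mulr0 scale0r subr0.
by rewrite addrAC (addrC p) addrK memvD ?memvN ?memvZ ?memv_line.
Qed.

(** * Orbits *)

Lemma orbit_of_self (R : realType) (n : nat) (H : set (affine R n)) p :
  isometry_subgroup H -> orbit_of H p p.
Proof. by case=> _ H1 _ _; exists (affine_one R n) => //; exact: act_one. Qed.

Lemma orbit_of_level (R : realType) (n : nat) (l : 'cV[R]_n.+1)
    (H : set (affine R n)) p :
  H `<=` level_group l -> orbit_of H p `<=` [set q | mink l q = mink l p].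
Proof. by move=> HL q [g /HL[_ gl] <-] /=. Qed.

(** A null rotation along w displaces p by <l, p> w modulo l, so w is obtained from
the wanted displacement q - p by division by <l, p>; this is where the level
has to be nonzero. *)
Lemma ruled_orbit (R : realType) (n : nat) (l p : 'cV[R]_n.+1) :
  mink l l = 0 -> mink l p != 0 ->
  orbit_of (ruled_group l) p = [set q | mink l q = mink l p].
Proof.
move=> ll lp; apply/seteqP; split.
  by apply: orbit_of_level => g [].
move=> q /= lq; pose w := (mink l p)^-1 *: (q - p).
have lw : mink l w = 0 by rewrite !mink_linE lq subrr mulr0.
(* The translation part cancels the l-component produced by the rotation. *)
exists (null_rotation l w, (mink w p + mink w w / 2 * mink l p) *: l).
  exact: ruled_groupW.
rewrite /act /= null_rotationE {1}/w scalerA divff // scale1r [p + _]addrC subrK.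
by rewrite (scalerDl l (mink w p)) -[q - _ - _]addrA -opprD subrK.
Qed.

Lemma translation_level (R : realType) (n : nat) (l w : 'cV[R]_n.+1) :
  mink l w = 0 -> level_group l (1%:M, w).
Proof.
move=> lw; split=> [u v|p]; first by rewrite !mul1mx.
by rewrite /act /= mul1mx minkDr lw addr0.
Qed.

Lemma level_orbit (R : realType) (n : nat) (l p : 'cV[R]_n.+1) :
  orbit_of (level_group l) p = [set q | mink l q = mink l p].
Proof.
apply/seteqP; split; first exact: orbit_of_level.
move=> q /= lq; exists (1%:M, q - p); last by rewrite /act /= mul1mx addrC subrK.
by apply: translation_level; rewrite !mink_linE lq subrr.
Qed.

(** * The degenerate hyperplane *)

Definition mink_perp (R : realType) (n : nat) (l : 'cV[R]_n.+1) :
    {vspace 'cV[R]_n.+1} :=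
  lker (linfun (mulmx (lower l) : 'cV[R]_n.+1 -> 'M[R]_1)).

Lemma mem_mink_perp (R : realType) (n : nat) (l v : 'cV[R]_n.+1) :
  (v \in mink_perp l) = (mink l v == 0).
Proof.
rewrite memv_ker lfunE /= mink_lower; apply/eqP/eqP => [/matrixP/(_ 0 0)|->].
  by rewrite !mxE eqxx mulr1n.
exact: raddf0.
Qed.

Lemma mink_perpE (R : realType) (n : nat) (l : 'cV[R]_n.+1) :
  [set v | v \in mink_perp l] = [set v | mink l v = 0].
Proof. by apply/seteqP; split=> v /=; rewrite mem_mink_perp => /eqP. Qed.

Lemma dim_mink_perp (R : realType) (n : nat) (l : 'cV[R]_n.+1) :
  l != 0 -> \dim (mink_perp l) = n.
Proof.
move=> l0; pose f := linfun (mulmx (lower l) : 'cV[R]_n.+1 -> 'M[R]_1).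
have dimcV m : \dim {:'cV[R]_m} = m by rewrite dimvf dim_matrix; exact: muln1.
have := limg_ker_dim f fullv; rewrite capfv dimcV -/(mink_perp l).
suff -> : \dim (f @: fullv) = 1%N by rewrite addn1 => -[].
apply/eqP; rewrite eqn_leq; apply/andP; split.
  by rewrite (leq_trans (dimvS (subvf _))) // dimcV.
rewrite lt0n dimv_eq0; apply: contra l0 => /eqP f0; apply/eqP.
apply: mink_nondegenerate => v; apply/eqP; rewrite -mem_mink_perp memv_ker -memv0.
by rewrite -f0 memv_img ?memvf.
Qed.

Lemma mink_perp_degenerate (R : realType) (n : nat) (l : 'cV[R]_n.+1) :
  l != 0 -> mink l l = 0 -> degenerate (mink_perp l).
Proof.
move=> l0 ll; exists l; split=> [||v]; rewrite ?mem_mink_perp ?ll //.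
by move/eqP.
Qed.

Lemma level_invariant (R : realType) (n : nat) (l : 'cV[R]_n.+1)
    (H : set (affine R n)) :
  isometry_subgroup H -> H `<=` level_group l ->
  invariant_set H [set v | v \in mink_perp l].
Proof.
move=> [HI _ _ HV] HL g Hg; rewrite mink_perpE; apply/seteqP; split.
  by move=> _ [v /= lv <-]; case: (HL _ Hg) => _ ->.
move=> v /= lv; exists (act (affine_inv g) v).
  by case: (HL _ (HV _ Hg)) => _ /= ->.
exact/act_invK/HI.
Qed.

(** * Cohomogeneity one *)

(** The difference quotients of a curve in a level lie in the orthogonal
complement of l, which is closed. *)
Lemma velocities_level (R : realType) (n : nat) (l p : 'cV[R]_n.+1) X :
  X `<=` [set q | mink l q = mink l p] ->
  velocities X p `<=` [set v | v \in mink_perp l].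
Proof.
move=> XL _ [c [[cD _] c0 cX <-]] /=; rewrite mem_mink_perp; apply/eqP.
have closed0 : closed [set v | mink l v = 0].
  apply: (@closed_comp _ _ (mink l) [set x | x = 0]); last exact: closed_eq.
  by move=> v _; exact: mink_continuous.
rewrite derive1E; apply: (closed_cvg _ closed0 _ _ (cD 0)).
apply: nearW => h /=; rewrite minkZr minkDr minkNr.
by rewrite !(XL _ (cX _)) subrr mulr0.
Qed.

Lemma line_C1 (R : realType) (n : nat) (p v : 'cV[R]_n.+1) :
  C1_curve (fun t : R => p + t *: v) /\
  derive1 (fun t : R => p + t *: v) = cst v.
Proof.
have cv (t : R) : h^-1 *: (((fun t => p + t *: v) \o shift t) (h *: 1) -
    (p + t *: v)) @[h --> 0^'] --> v.
  apply: cvg_near_cst; near=> h.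
  have h0 : h != 0 by near: h; exact: nbhs_dnbhs_neq.
  rewrite /= [h *: 1]mulr1 opprD addrACA subrr add0r -scalerBl addrK scalerA.
  by rewrite mulVf // scale1r.
have E : derive1 (fun t : R => p + t *: v) = cst v.
  by apply/funext => t; rewrite derive1E; apply: cvg_lim => //; exact: cv.
split=> //; split=> [t|]; first by apply/cvg_ex; exists v; exact: cv.
by rewrite E => t; exact: cvg_cst.
Unshelve. all: by end_near.
Qed.

(** Straight lines already realize every vector of the hyperplane as a velocity. *)
Lemma level_tangent_space (R : realType) (n : nat) (l p : 'cV[R]_n.+1) :
  tangent_space [set q | mink l q = mink l p] p (mink_perp l).
Proof.
split; first exact: velocities_level.
move=> U XU; apply/subvP => v; rewrite mem_mink_perp => /eqP lv; apply: XU.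
exists (fun t => p + t *: v); have [C1 E] := line_C1 p v; split=> //.
- by rewrite scale0r addr0.
- by move=> t /=; rewrite minkDr minkZr lv mulr0 addr0.
- by rewrite E.
Qed.

(** Every orbit lies in a level, so no tangent space exceeds the hyperplane; one
orbit filling a level attains the bound. *)
Lemma level_cohomogeneity_one (R : realType) (n : nat) (l p : 'cV[R]_n.+1)
    (H : set (affine R n)) :
  l != 0 -> H `<=` level_group l ->
  orbit_of H p = [set q | mink l q = mink l p] -> cohomogeneity_one H.
Proof.
move=> l0 HL Hp; split.
  exists p, (mink_perp l); first by rewrite Hp; exact: level_tangent_space.
  by rewrite dim_mink_perp // subSnn.
move=> q k [T [_ Tmin] ->]; rewrite subn_gt0 ltnS.
apply: leq_trans (eq_leq (dim_mink_perp l0)).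
by apply/dimvS/Tmin/velocities_level/orbit_of_level.
Qed.

(** * Orbit equivalence off the hyperplane and on it *)

Lemma orbit_equivalent_same (R : realType) (n : nat) (X : set 'cV[R]_n.+1)
    (H1 H2 : set (affine R n)) :
  isometry_subgroup H1 -> isometry_subgroup H2 ->
  (forall p, X p -> orbit_of H1 p = orbit_of H2 p) ->
  orbit_equivalent_on X H1 H2.
Proof.
move=> H1g H2g E; have [_ I1 _ _] := isometry_subgroup_isometries R n.
have act1 : act (affine_one R n) = id by apply/funext => p; exact: act_one.
exists (affine_one R n); rewrite act1; split; [exact: I1|exact: image_id|].
have -> : (fun O : set 'cV[R]_n.+1 => id @` O) = id.
  by apply/funext => O; exact: image_id.
rewrite image_id; apply/seteqP; split=> _ [[p ->] OX]; split=> //; exists p;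
  rewrite E //; apply: OX; exact: orbit_of_self.
Qed.

(** The hyperplane W is one orbit of the level group.  An orbit equivalence f on W
would map some orbit of the ruled group onto W = f(W), so that by injectivity
this orbit would be W; but it lies in a line. *)
Lemma ruled_not_equivalent (R : realType) (n : nat) (l : 'cV[R]_n.+1) :
  (1 < n)%N -> l != 0 ->
  ~ orbit_equivalent_on [set v | v \in mink_perp l] (ruled_group l) (level_group l).
Proof.
set W := [set v | _]; move=> n1 l0 [f [fI fW fO]].
have WO : orbits_in (level_group l) W W.
  split=> //; exists 0; rewrite level_orbit /W mink_perpE.
  by rewrite mink0r.
rewrite -fO in WO; case: WO => _ [[p ->] OW] fOW.
have {fOW} OE : W `<=` orbit_of (ruled_group l) p.
  move=> w Ww; have: W (act f w) by rewrite -fW; exists w.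
  by rewrite -fOW => -[q qO /(act_inj fI) <-].
have lp : mink l p = 0.
  move: (OW _ (orbit_of_self p (ruled_group_subgroup l))).
  by rewrite /W mink_perpE.
have line w : W w -> w - p \in <[l]>%VS.
  by move=> /OE[g [_ gr] <-]; exact: gr.
have: (mink_perp l <= <[l]>)%VS.
  apply/subvP => w Ww; rewrite -(subrK p w) memvD ?line //.
  by rewrite -memvN -sub0r line // /W /= mem0v.
by move/dimvS; rewrite dim_mink_perp // dim_vline l0 leqNgt n1.
Qed.

Theorem corollary4p3 (R : realType) (n : nat) (hn : (3 <= n)%N) :
  exists (W : {vspace 'cV[R]_n.+1}) (H1 H2 : set (affine R n)),
    [/\ \dim W = n /\ degenerate W,
        [/\ isometry_subgroup H1, cohomogeneity_one H1
          & invariant_set H1 [set v | v \in W]],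
        [/\ isometry_subgroup H2, cohomogeneity_one H2
          & invariant_set H2 [set v | v \in W]],
        orbit_equivalent_on (~` [set v | v \in W]) H1 H2
      & ~ orbit_equivalent_on [set v | v \in W] H1 H2].
Proof.
(* l is the sum of a spacelike and a timelike basis vector, of squares 1 and -1;
   e is a point of nonzero level. *)
pose e : 'cV[R]_n.+1 := delta_mx ord_max 0.
pose l := delta_mx ord0 0 + e.
have n0 : (ord0 == ord_max :> 'I_n.+1) = false.
  by rewrite -val_eqE /= ltn_eqF // ltnW // ltnW.
have n0' : (ord_max == ord0 :> 'I_n.+1) = false by rewrite eq_sym n0.
have le : mink l e != 0.
  by rewrite mink_delta eqxx !mxE !eqxx n0' /= add0r oppr_eq0 oner_eq0.
have ll : mink l l = 0.
  rewrite {2}/l minkDr !mink_delta !mxE !eqxx n0 n0' /=.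
  by rewrite addr0 add0r subrr.
have l0 : l != 0.
  by apply: contra le => /eqP ->; rewrite minkC mink0r.
have Hr := ruled_group_subgroup l; have Hl := level_group_subgroup l.
have rl : ruled_group l `<=` level_group l by move=> g [].
exists (mink_perp l), (ruled_group l), (level_group l); split.
- by split; [exact: dim_mink_perp | exact: mink_perp_degenerate].
- split=> //; last exact: level_invariant.
  exact: (level_cohomogeneity_one l0 rl (ruled_orbit ll le)).
- split=> //; last exact: level_invariant.
  exact: (level_cohomogeneity_one l0 _ (level_orbit l e)).
- apply: orbit_equivalent_same => // p /= /negP; rewrite mem_mink_perp => lp.
  by rewrite level_orbit ruled_orbit.
- by apply: ruled_not_equivalent => //; exact: ltnW.
Qed.
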